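(* Let $Q=S(G,\theta)$ be a bisimple inverse $\omega$-semigroup and let $S$ be a left I-order in $Q$. Then $S\cap L_n\neq\emptyset$ for all $n\in\mathbb{N}^0$, where $L_n$ is the $\mathcal{L}$-class of $Q$ containing the idempotent $e_n$.
   Context: $\mathbb{N}^0$ is the set of non-negative integers. A subsemigroup $S$ of an inverse semigroup $Q$ is a left I-order in $Q$ if every element of $Q$ can be written as $a^{-1}b$ with $a,b\in S$, where $a^{-1}$ is the inverse of $a$ in $Q$ in the sense of inverse semigroup theory. A bisimple inverse $\omega$-semigroup is an inverse semigroup with a single $\mathcal{D}$-class whose idempotents form an $\omega$-chain $e_0\geqslant e_1\geqslant e_2\geqslant\cdots$, with $e_m\leqslant e_n$ if and only if $m\geqslant n$. By Reilly's theorem every bisimple inverse $\omega$-semigroup is, up to isomorphism, of the form $S(G,\theta)$, where $G$ is a group, $\theta$ an endomorphism of $G$, and $S(G,\theta)=\mathbb{N}^0\times G\times\mathbb{N}^0$ with multiplication $(m,g,n)(p,h,q)=(m-n+t,(g\theta^{t-n})(h\theta^{t-p}),q-p+t)$, $t=\max\{n,p\}$, with $\theta^0$ the identity map. Here $e_n=(n,1,n)$, $(m,g,n)^{-1}=(n,g^{-1},m)$, and $L_n=\{(m,a,n):a\in G,\ m\in\mathbb{N}^0\}$. *)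

(* Defs.v *)
From HB Require Import structures.
From mathcomp Require Import all_boot.
From mathcomp Require Import classical_sets.
From mathcomp Require Import zify.

Set Implicit Arguments.
Unset Strict Implicit.
Unset Printing Implicit Defensive.

Local Open Scope classical_set_scope.
Local Open Scope group_scope.

Section SemigroupNotions.
Variable Q : semigroupType.
Implicit Types (a b x y : Q) (S : set Q).

Definition is_inverse a b : Prop := a * b * a = a /\ b * a * b = b.

Definition inverse_semigroup : Prop := forall a, exists! b, is_inverse a b.

Definition subsemigroup S : Prop := forall x y, S x -> S y -> S (x * y).

(* Meant for an inverse semigroup Q, where the witness a' can only be the
   inverse of a. *)
Definition left_I_order S : Prop :=
  subsemigroup S /\
  forall q, exists a b a', [/\ S a, S b, is_inverse a a' & q = a' * b].

(* Q^1 a, where Q^1 is Q with an identity adjoined if necessary. *)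
Definition principal_left_ideal a : set Q :=
  [set x | x = a \/ exists u, x = u * a].

Definition green_L a b : Prop :=
  principal_left_ideal a = principal_left_ideal b.

Definition Lclass a : set Q := [set x | green_L x a].

End SemigroupNotions.

(* The carrier of S(G, theta); theta only serves to select the product. *)
Definition reilly (G : groupType) (theta : {multiplicative G -> G}) : Type :=
  (nat * G * nat)%type.

HB.instance Definition _ (G : groupType) (theta : {multiplicative G -> G}) :=
  Choice.copy (reilly theta) (nat * G * nat)%type.

Section Reilly.
Variables (G : groupType) (theta : {multiplicative G -> G}).
Implicit Types x y : reilly theta.

(* m - n + t and q - p + t are written m + (t - n) and q + (t - p), which
   avoids the truncation of m - n and q - p since n, p <= t. *)
Definition reilly_mul x y : reilly theta :=
  let: (m, g, n) := x in let: (p, h, q) := y in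
  let t := maxn n p in
  ((m + (t - n))%N, iter (t - n) theta g * iter (t - p) theta h,
   (q + (t - p))%N).

Lemma iter_gmulfM k : {morph iter k theta : x y / x * y}.
Proof. by move=> x y; elim: k => //= k ->; rewrite gmulfM. Qed.

Lemma reilly_mulA : associative reilly_mul.
Proof.
move=> [[m g] n] [[p h] q] [[r k] s] /=.
rewrite !iter_gmulfM -!iterD mulgA.
congr (_, _ * _ * _, _); try congr (iter _ _ _); lia.
Qed.

HB.instance Definition _ :=
  isSemigroup.Build (reilly theta) reilly_mulA.

Definition reilly_idem (n : nat) : reilly theta := (n, 1, n).

Lemma reilly_mulE (m n p q : nat) (g h : G) :
  ((m, g, n) : reilly theta) * ((p, h, q) : reilly theta) =
  ((m + (maxn n p - n))%N,
   iter (maxn n p - n) theta g * iter (maxn n p - p) theta h,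
   (q + (maxn n p - p))%N).
Proof. by []. Qed.

Lemma reilly_inverseP (m n : nat) (g : G) y :
  is_inverse ((m, g, n) : reilly theta) y <-> y = (n, g^-1, m).
Proof.
case: y => [[p h] q]; split=> [[]|[-> -> ->]].
  rewrite !reilly_mulE => -[E1 + E2] [E3 _ E4].
  have -> : p = n by lia.
  have -> : q = m by lia.
  rewrite !(maxnn, subnn, addn0) /= => /(canRL (mulgK _)).
  rewrite mulgV => /(canRL (mulKg _)) ->.
  by rewrite mulg1.
by rewrite /is_inverse !(reilly_mulE, maxnn, subnn, addn0) /= mulgV mul1g
  mulVg mul1g.
Qed.

Lemma reilly_inverse_semigroup : inverse_semigroup (reilly theta).
Proof.
case=> [[m g] n]; exists (n, g^-1, m); split; first exact/reilly_inverseP.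
by move=> y /reilly_inverseP ->.
Qed.

Lemma Lclass_reilly_idemE n :
  Lclass (reilly_idem n) = [set x : reilly theta | exists m a, x = (m, a, n)].
Proof.
have lt x y : principal_left_ideal y x -> (y.2 <= x.2)%N.
  case=> [->//|[[[p h] q]]]; case: y => [[m g] n'] ->.
  by rewrite reilly_mulE /=; lia.
apply/seteqP; split=> [[[m g] l] /= H|_ /= [m [g ->]]].
  have H1 : principal_left_ideal (reilly_idem n) (m, g, l).
    by rewrite -H; left.
  have H2 : principal_left_ideal ((m, g, l) : reilly theta) (reilly_idem n).
    by rewrite H; left.
  have /= := lt _ _ H1; have /= := lt _ _ H2 => le1 le2.
  by exists m, g; congr (_, _, _); lia.
pose x0 : reilly theta := (m, g, n); pose y0 : reilly theta := (n, g^-1, m).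
have E1 : x0 = x0 * reilly_idem n.
  by rewrite reilly_mulE !(maxnn, subnn, addn0) /= mulg1.
have E2 : reilly_idem n = y0 * x0.
  by rewrite reilly_mulE !(maxnn, subnn, addn0) /= mulVg.
apply/seteqP; split=> x /= [->|[u ->]]; right.
- by exists x0.
- by exists (u * x0); rewrite -mulgA -E1.
- by exists y0.
- by exists (u * y0); rewrite E2 mulgA.
Qed.

End Reilly.

(* Main.v *)
(* Write e_n = a^{-1} b with a = (m, g, i) and b = (p, h, j) in S. Then
   i + (t - m) = n = j + (t - p) for t = max(m, p): if t = m then i = n and
   a lies in L_n, and if t = p then j = n and b does. *)
Require Import Defs.
From mathcomp Require Import all_boot classical_sets.

Local Open Scope classical_set_scope.

Theorem lemma2p1 (G : groupType) (theta : {multiplicative G -> G})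
  (S : set (reilly theta)) (hS : left_I_order S) (n : nat) :
  S `&` Lclass (reilly_idem theta n) !=set0.
Proof.
case: hS => _ /(_ (reilly_idem theta n)).
(* Inversion swaps the outer coordinates: [a'] becomes [(i, g^-1, m)], so the last coordinate [i] of
   the first factor reappears on the left of the product. *)
case=> [[[m g] i]] [[[p h] j]] [a' [Sa Sb /reilly_inverseP ->]].
(* The L-class is determined by the last coordinate alone, so only the equations [ni] and [nj]
   between outer coordinates are kept. *)
rewrite reilly_mulE Lclass_reilly_idemE => -[ni _ nj].
(* When [m = p] both elements lie in the L-class; the tie is settled in favour of [(m, g, i)]. *)
have [le_pm|/ltnW le_mp] := leqP p m.
  exists (m, g, i); split=> //; exists m, g.
  by rewrite ni (maxn_idPl le_pm) subnn addn0.
exists (p, h, j); split=> //; exists p, h.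
by rewrite nj (maxn_idPr le_mp) subnn addn0.
Qed.
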